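(* Let $Q$ be a symmetric function and let $\mu$ be a strict partition. For $n\ge 0$ put $$P(n)=\sum_{|\lambda/\mu|=n}\frac{2^{|\lambda|-|\mu|-\ell(\lambda)+\ell(\mu)}f_{\lambda/\mu}}{H_{\lambda}}\,Q\Bigl(\tbinom{c_{\square}}{2}:\square\in\lambda\Bigr),$$ where the sum ranges over all strict partitions $\lambda\supseteq\mu$ with $|\lambda|-|\mu|=n$. Then $P(n)$ is a polynomial in $n$.
   Context: A strict partition is a finite strictly decreasing sequence of positive integers $\lambda=(\lambda_1>\lambda_2>\cdots>\lambda_\ell)$ (the empty sequence $\emptyset$ is allowed); $|\lambda|=\sum_i\lambda_i$ is its size, $\ell(\lambda)=\ell$ its length, and $\lambda_i=0$ for $i>\ell(\lambda)$. The (shifted Young) diagram of $\lambda$ is the set of boxes $(i,j)$ with $1\le i\le \ell(\lambda)$ and $i+1\le j\le i+\lambda_i$ (row $i$, column $j$); $\lambda$ is identified with its diagram. The content of a box $\square=(i,j)$ is $c_\square=j-i$. The hook length $h_\square$ of $\square=(i,j)\in\lambda$ is the number of boxes of $\lambda$ in row $i$ strictly to the right of $\square$, plus the number of boxes $(i',j)\in\lambda$ with $i'>i$, plus $1$, plus $\lambda_j$. $H_\lambda=\prod_{\square\in\lambda}h_\square$ ($H_\emptyset=1$). For strict partitions write $\lambda\supseteq\mu$ if $\lambda_i\ge\mu_i$ for all $i$; then $\lambda/\mu$ denotes the set of boxes of $\lambda$ not in $\mu$, and $|\lambda/\mu|=|\lambda|-|\mu|$. $f_{\lambda/\mu}$ is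 the number of standard shifted Young tableaux of shape $\lambda/\mu$, i.e. bijective fillings of the boxes of $\lambda/\mu$ with $1,\dots,|\lambda/\mu|$ increasing from left to right along rows and from top to bottom along columns ($f_{\mu/\mu}=1$). For a symmetric function $Q$ (in infinitely many variables), $Q(\binom{c_\square}{2}:\square\in\lambda)$ means that $|\lambda|$ of the variables are specialized to the values $\binom{c_\square}{2}$, $\square\in\lambda$, and all other variables to $0$. *)

(* Defs.v *)
From HB Require Import structures.
From mathcomp Require Import all_boot all_order all_algebra all_fingroup.
From mathcomp Require Import mpoly.
Set Implicit Arguments. Unset Strict Implicit. Unset Printing Implicit Defensive.
Import Order.TTheory GRing.Theory Num.Theory.

(* A strict partition is a seq nat [:: l_1; ...; l_l] strictly decreasing with
   positive parts.  Rows/columns are 1-indexed as in the paper. *)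
Definition is_strict (l : seq nat) : bool :=
  sorted (fun a b => b < a) l && all (fun x => 0 < x) l.

Definition psize (l : seq nat) : nat := sumn l.
Definition plength (l : seq nat) : nat := size l.
(* lambda_i, 1-indexed, = 0 for i > ell(lambda) (and for i = 0) *)
Definition part (l : seq nat) (i : nat) : nat := if i is i'.+1 then nth 0 l i' else 0.

Definition pcontains (l m : seq nat) : bool :=
  all (fun i => part m i <= part l i) (iota 1 (size l + size m)).

(* boxes (i,j) of the shifted diagram: 1 <= i <= ell, i+1 <= j <= i + lambda_i *)
Definition boxes (l : seq nat) : seq (nat * nat) :=
  flatten [seq [seq (i, j) | j <- iota i.+1 (part l i)] | i <- iota 1 (size l)].

Definition in_diag (l : seq nat) (b : nat * nat) : bool := b \in boxes l.

Definition skew_boxes (l m : seq nat) : seq (nat * nat) :=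
  [seq b <- boxes l | ~~ in_diag m b].

(* content c = j - i (always >= 1 here) *)
Definition content (b : nat * nat) : nat := b.2 - b.1.

Definition hook (l : seq nat) (b : nat * nat) : nat :=
  let: (i, j) := b in
  count (fun b' => (b'.1 == i) && (j < b'.2)) (boxes l)
  + count (fun b' => (b'.2 == j) && (i < b'.1)) (boxes l)
  + 1 + part l j.

Definition Hprod (l : seq nat) : nat := \prod_(b <- boxes l) hook l b.

(* number of standard shifted Young tableaux of shape lambda/mu:
   bijective fillings of the boxes (indexed by 'I_n via skew_boxes) with
   1..n (encoded as 0..n-1), increasing along rows and columns *)
Definition nSYT (l m : seq nat) : nat :=
  let bx := skew_boxes l m in
  let n := size bx in
  #|[set T : {ffun 'I_n -> 'I_n} | injectiveb T &&
     [forall k1 : 'I_n, forall k2 : 'I_n,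
        let b1 := nth (0, 0) bx k1 in let b2 := nth (0, 0) bx k2 in
        (((b1.1 == b2.1) && (b1.2 < b2.2)) || ((b1.2 == b2.2) && (b1.1 < b2.1)))
          ==> (T k1 < T k2)]]|.

Definition part_of_set N (A : {set 'I_N.+1}) : seq nat :=
  sort geq [seq val i | i <- enum A & val i != 0].
Definition small_strict_parts (N : nat) : seq (seq nat) :=
  undup [seq part_of_set A | A : {set 'I_N.+1}].

(* A symmetric function (in infinitely many variables) over R is a family of
   symmetric polynomials Q_k in k variables of bounded degree, compatible
   with setting the last variable to 0 (projective limit description). *)
Definition ext0 (R : comNzRingType) k (v : 'I_k -> R) : 'I_k.+1 -> R :=
  fun i => if unlift ord_max i is Some j then v j else 0%R.

Definition is_symfun (R : comNzRingType) (Q : forall k, {mpoly R[k]}) : Prop :=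
  [/\ forall k, Q k \is symmetric,
      exists d, forall k, (msize (Q k) <= d)%N
    & forall k (v : 'I_k -> R), (Q k.+1).@[ext0 v] = (Q k).@[v]].

Local Open Scope ring_scope.

(* Q(binom(c_box,2) : box in lambda): |lambda| variables specialised to these
   values, all the others to 0 *)
Definition Qcontents (R : comNzRingType) (Q : forall k, {mpoly R[k]}) (l : seq nat) : R :=
  (Q (size (boxes l))).@[fun i : 'I_(size (boxes l)) =>
       ('C(content (nth (0, 0) (boxes l) i), 2))%N%:R].

Definition Psum (R : numFieldType) (Q : forall k, {mpoly R[k]}) (mu : seq nat)
    (n : nat) : R :=
  \sum_(lam <- small_strict_parts (psize mu + n)
          | is_strict lam && pcontains lam mu && (psize lam == psize mu + n)%N)
     (2%:R : R) ^ ((psize lam)%:Z - (psize mu)%:Z - (plength lam)%:Z + (plength mu)%:Z)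
     * (nSYT lam mu)%:R / (Hprod lam)%:R * Qcontents Q lam.

(* Main.v *)
(* Write F(lambda) = 2^(|lambda| - l(lambda)) / H_lambda.  Since f_(lambda/mu)
   counts the ways of growing mu into lambda box by box, P(n) is a constant
   times (U^n g)(mu), where g(lambda) = Q(binom(c, 2)) and U averages a function
   over the ways of adding a box, with weights F(lambda+) / F(lambda).

   With x_m = binom(m + 1, 2) and y_m = binom(m, 2), the weight of adding a box
   to a row of length m is the residue at z = x_m of
       A(z) / B(z),   A = prod_i (z - y_(lambda_i)),  B = z prod_i (z - x_(lambda_i)),
   and x_m is also the value binom(c, 2) at the new box.  Let M_k be the sum of
   all residues of z^k A / B.  Adding the box multiplies A / B by
   (z - x_m)^2 / ((z - y_m)(z - x_(m+1))), whose denominator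
   z^2 - (2 x_m + 1) z + x_m (x_m - 1) is polynomial in x_m.  So, with M_k of
   weight k and the elementary symmetric function e_k of the binom(c, 2) of
   weight 2k, adding a box changes a polynomial in the M_k and e_k by a
   polynomial in x_m and these functions of smaller weight (x_m has weight 1).
   Averaging turns x_m^k into M_k, hence U - 1 lowers weights and is nilpotent
   on g, and U^n = sum_k binom(n, k) (U - 1)^k. *)

Require Import Defs.
From HB Require Import structures.
From mathcomp Require Import all_boot all_order all_algebra all_fingroup.
From mathcomp Require Import mpoly.
From mathcomp Require Import ring zify.
Set Implicit Arguments. Unset Strict Implicit. Unset Printing Implicit Defensive.
Import Order.TTheory GRing.Theory Num.Theory.
Local Open Scope ring_scope.

(** * Sum of residues of a rational function *)

Section Residue.
Variable K : fieldType.
Implicit Types (f g B C : {poly K}).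

(* For B monic, the coefficient of 1/X in the expansion of f / B at infinity. *)
Definition residue B f : K := (f %% B)`_(size B).-2.

Lemma residueD B f g : residue B (f + g) = residue B f + residue B g.
Proof. by rewrite /residue modpD coefD. Qed.

Lemma residueZ B c f : residue B (c *: f) = c * residue B f.
Proof. by rewrite /residue modpZl coefZ. Qed.

(** The residue depends only on the fraction f / B: the remainder of C f modulo C B is C (f %% B),
    and as C is monic the relevant coefficient does not change. *)
Lemma residue_mull B C f : B \is monic -> C \is monic -> (1 < size B)%N ->
  residue (C * B) (C * f) = residue B f.
Proof.
move=> mB mC sB; rewrite /residue.
have B0 := monic_neq0 mB; have C0 := monic_neq0 mC.
have [c sC] : exists c, size C = c.+1.
  by exists (size C).-1; rewrite prednK // size_poly_gt0.
have [b {}sB] : exists b, size B = b.+2.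
  by exists (size B).-2; case: (size B) sB => [|[]].
have sr : (size (f %% B)%R <= b.+1)%N by rewrite -ltnS -sB ltn_modpN0.
have -> : (C * f) %% (C * B) = C * (f %% B).
  apply/esym/(@modpP _ _ (f %/ B)).
    by rewrite {1}(divp_eq f B) mulrDr; congr (_ + _); ring.
  have [->|r0] := eqVneq (f %% B) 0.
    by rewrite mulr0 size_poly0 size_poly_gt0 mulf_neq0.
  by rewrite !size_mul // sC sB !addSn /= -addnS leq_add2l ltnS.
rewrite size_mul // sC sB addSn /= addnS /= coefM; move: sr; set r := f %% B => sr.
have lt : (c < (c + b.+1).-1.+1)%N by lia.
rewrite (bigD1 (Ordinal lt)) //= big1 ?addr0 => [|i ne].
  have := monicP mC; rewrite lead_coefE sC /= => ->.
  by rewrite mul1r addnS /= addKn.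
have [lti|gei] := ltnP i c.
  by rewrite [X in _ * X]nth_default ?mulr0 // (leq_trans sr) //; lia.
rewrite nth_default ?mul0r // sC; move: ne; rewrite -val_eqE /=; lia.
Qed.

Lemma eq_residue B C f g : B \is monic -> C \is monic ->
  (1 < size B)%N -> (1 < size C)%N -> C * f = B * g -> residue B f = residue C g.
Proof.
move=> mB mC sB sC eqfg.
by rewrite -(residue_mull f mB mC) // eqfg mulrC residue_mull.
Qed.

(* The [(size s).-1]-st coefficient of the interpolation formula for f mod B. *)
Lemma residue_sum (s : seq K) f (B := \prod_(c <- s) ('X - c%:P)) :
  uniq s -> s != [::] -> residue B f = \sum_(c <- s) f.[c] / B^`().[c].
Proof.
move=> us s0.
have s_gt0 : (0 < size s)%N by case: (s) s0.
have sB : size B = (size s).+1 by rewrite size_prod_XsubC.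
have B0 : B != 0 by rewrite -size_poly_gt0 sB.
have BD c : c \in s -> B = ('X - c%:P) * \prod_(d <- rem c s) ('X - d%:P).
  by move=> cs; rewrite -(big_cons _ _ _ _ xpredT (fun d => 'X - d%:P));
    apply/perm_big/perm_to_rem.
have dB c : c \in s -> B^`().[c] = (\prod_(d <- rem c s) ('X - d%:P)).[c].
  move=> cs; rewrite {1}(BD c cs) derivM derivXsubC mul1r hornerD hornerM.
  by rewrite !hornerXsubC subrr mul0r addr0.
have dB0 c : c \in s -> B^`().[c] != 0.
  move=> cs; rewrite dB // -/(root _ c) root_prod_XsubC mem_rem_uniq // inE.
  by rewrite eqxx.
pose L := \sum_(c <- s) (f.[c] / B^`().[c]) *: \prod_(d <- rem c s) ('X - d%:P).
have sL : (size L <= size s)%N.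
  rewrite /L big_seq; apply: (big_ind (fun p : {poly K} => size p <= size s)%N).
  - by rewrite size_poly0.
  - by move=> p q ps qs; rewrite (leq_trans (size_polyD _ _)) // geq_max ps.
  move=> c cs; rewrite (leq_trans (size_scale_leq _ _)) //.
  by rewrite size_prod_XsubC size_rem // prednK.
have hL c : c \in s -> L.[c] = f.[c].
  move=> cs; rewrite /L horner_sum (bigD1_seq c) //= [X in _ + X]big1_seq ?addr0.
    by rewrite hornerZ -(dB _ cs) divfK ?dB0.
  move=> d /andP[dc ds]; rewrite hornerZ.
  apply/eqP; rewrite mulf_eq0; apply/orP; right.
  by rewrite -/(root _ c) root_prod_XsubC mem_rem_uniq // inE cs eq_sym dc.
have -> : residue B f = L`_(size s).-1.
  rewrite /residue sB /=; suff -> : f %% B = L by [].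
  apply/eqP; rewrite -subr_eq0; apply/eqP/(@roots_geq_poly_eq0 _ _ s) => //.
    apply/allP => c cs; rewrite /root hornerD hornerN hL // horner_mod ?subrr //.
    by rewrite root_prod_XsubC.
  rewrite (leq_trans (size_polyD _ _)) // geq_max size_polyN sL andbT.
  by have := ltn_modpN0 f B0; rewrite sB.
rewrite /L coef_sum big_seq [RHS]big_seq; apply: eq_bigr => c cs.
rewrite coefZ -[RHS]mulr1; congr (_ * _).
have := monicP (monic_prod_XsubC (rem c s) xpredT id).
by rewrite lead_coefE size_prod_XsubC /= size_rem.
Qed.

End Residue.

(** * Moments of the transition weights *)

Lemma is_strict_cons a l :
  is_strict (a :: l) = [&& (0 < a)%N, all (fun b => b < a)%N l & is_strict l].
Proof.
have tr : transitive (fun a b => b < a)%N by move=> u v w uv /ltn_trans; apply.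
rewrite /is_strict /= (path_sortedE tr).
by rewrite -!andbA; do !bool_congr.
Qed.

(** The appended 0 is the empty row; distinctness makes the roots of [denom] simple. *)
Lemma is_strict_uniq l : is_strict l -> uniq (rcons l 0%N).
Proof.
elim: l => //= a l IH; rewrite is_strict_cons => /and3P[a0 /allP al /IH ->].
rewrite andbT mem_rcons inE negb_or -lt0n a0 /=.
by apply/negP => /al; rewrite ltnn.
Qed.

Section Moments.
Variable R : numFieldType.
Implicit Types (l : seq nat) (m i k : nat).

Definition xnode m : R := 'C(m.+1, 2)%:R.
Definition ynode m : R := 'C(m, 2)%:R.

Lemma xnodeE m : xnode m = m%:R * (m%:R + 1) / 2.
Proof.
rewrite /xnode; elim: m => [|m IH]; first by rewrite mul0r mul0r.
by rewrite binS bin1 natrD IH -natr1; field.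
Qed.

Lemma ynodeE m : ynode m = m%:R * (m%:R - 1) / 2.
Proof.
case: m => [|m]; first by rewrite /ynode mul0r mul0r.
by rewrite -[ynode _]/(xnode m) xnodeE -natr1; field.
Qed.

Lemma xnode_inj : injective xnode.
Proof.
have mono : {mono (fun m => 'C(m.+1, 2)) : m n / (m < n)%N}.
  apply: leqW_mono; apply: leq_mono => m n; elim: n => // n IH.
  have -> : 'C(n.+2, 2) = ('C(n.+1, 2) + n.+1)%N by rewrite binS bin1.
  by rewrite ltnS leq_eqVlt => /orP[/eqP->|/IH]; lia.
move=> m n /eqP; rewrite /xnode eqr_nat => /eqP e.
by case: (ltngtP m n) => // lt; have := lt; rewrite -mono /= e ltnn.
Qed.

Definition numer l : {poly R} := \prod_(m <- l) ('X - (ynode m)%:P).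
(* The extra node [xnode 0 = 0] accounts for a new row. *)
Definition denom l : {poly R} :=
  \prod_(c <- map xnode (rcons l 0%N)) ('X - c%:P).

Lemma numer_cons a l : numer (a :: l) = ('X - (ynode a)%:P) * numer l.
Proof. by rewrite /numer big_cons. Qed.

Lemma denom_cons a l : denom (a :: l) = ('X - (xnode a)%:P) * denom l.
Proof. by rewrite /denom /= big_cons. Qed.

Lemma denom_nil : denom [::] = 'X.
Proof. by rewrite /denom /= big_seq1 subr0. Qed.

Lemma denom_monic l : denom l \is monic.
Proof. by rewrite /denom; apply: monic_prod_XsubC. Qed.

Lemma size_denom l : size (denom l) = (size l).+2.
Proof. by rewrite /denom size_prod_XsubC size_map size_rcons. Qed.

Lemma size_numer l : size (numer l) = (size l).+1.
Proof. by rewrite /numer size_prod_XsubC. Qed.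

(* Adding a box to a row of length m multiplies numer / denom by
   (X - x_m)^2 / ((X - y_m)(X - x_(m+1))). *)
Lemma numer_denom_incr l i (m := nth 0%N l i) : (i <= size l)%N ->
  numer (incr_nth l i) * denom l * (('X - (ynode m)%:P) * ('X - (xnode m.+1)%:P))
  = numer l * denom (incr_nth l i) * ('X - (xnode m)%:P) ^+ 2.
Proof.
rewrite {}/m; elim: l i => [|a l IH] [|i] //= il.
- rewrite !(numer_cons, denom_cons) denom_nil /numer big_nil.
  by rewrite -/(xnode 0); rewrite (_ : ynode 0 = 0) // (_ : ynode 1 = 0) //
    (_ : xnode 0 = 0) //; ring.
(* Both nodes are binom(a + 1, 2), which produces the double zero at x_a. *)
- by rewrite !(numer_cons, denom_cons) (_ : ynode a.+1 = xnode a) //; ring.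
- rewrite !(numer_cons, denom_cons) -!mulrA; congr (_ * _).
  rewrite !mulrA -[RHS]mulrA -[RHS]mulrA.
  transitivity (('X - (xnode a)%:P) * (numer (incr_nth l i) * denom l *
     (('X - (ynode (nth 0 l i))%:P) * ('X - (xnode (nth 0 l i).+1)%:P))));
       first by ring.
  by rewrite IH //; ring.
Qed.

(** With [node_prod], Vieta: the quadratic with roots y_m and x_(m+1) has coefficients polynomial in
    x_m. *)
Lemma node_sum m : ynode m + xnode m.+1 = 2 * xnode m + 1.
Proof. by rewrite ynodeE !xnodeE -natr1; field. Qed.

Lemma node_prod m : ynode m * xnode m.+1 = xnode m * (xnode m - 1).
Proof. by rewrite ynodeE !xnodeE -natr1; field. Qed.

(** M_k, read off at infinity: [mom_incr] is then a formal identity, and [mom_sum] recovers the sum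
    over the poles. *)
Definition mom k l : R := residue (denom l) ('X^k * numer l).

(** The residue of A / B at the simple pole of row i; for i = size l the default 0 of [nth] gives
    the empty row. *)
Definition weight l i : R :=
  (numer l).[xnode (nth 0%N l i)] / (denom l)^`().[xnode (nth 0%N l i)].

Lemma mom_sum k l : is_strict l ->
  mom k l = \sum_(i < (size l).+1) weight l i * xnode (nth 0%N l i) ^+ k.
Proof.
move=> sl; rewrite /mom {1}/denom residue_sum; last 2 first.
- by rewrite map_inj_uniq ?is_strict_uniq //; apply: xnode_inj.
- by rewrite -size_eq0 size_map size_rcons.
rewrite big_map (big_nth 0%N) size_rcons big_mkord; apply: eq_bigr => i _.
have -> : nth 0%N (rcons l 0%N) i = nth 0%N l i.
  have := ltn_ord i; rewrite ltnS leq_eqVlt nth_rcons => /orP[/eqP->|->//].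
  by rewrite ltnn eqxx nth_default.
by rewrite -/(denom l) /weight hornerM hornerXn -mulrA mulrC.
Qed.

(** A and B are monic with degrees differing by one, so A / B behaves as 1 / z at infinity. By
    [mom_sum] the weights thus sum to 1. *)
Lemma mom0 l : mom 0 l = 1.
Proof.
rewrite /mom expr0 mul1r /residue size_denom modp_small ?size_numer ?size_denom //.
have := monic_prod_XsubC l xpredT ynode.
by rewrite -/(numer l) => /monicP; rewrite lead_coefE size_numer.
Qed.

(** At infinity z A / B = 1 + (sum of the x_m - sum of the y_m) / z + ..., and x_m - y_m = m. *)
Lemma mom1 l : mom 1 l = (sumn l)%:R.
Proof.
rewrite /mom expr1 /residue size_denom /=.
have -> : ('X * numer l) %% denom l = 'X * numer l - denom l.
  apply/esym/(@modpP _ _ 1); first by rewrite mul1r addrC subrK.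
  elim: l => [|a l IH].
    by rewrite denom_nil /numer big_nil mulr1 subrr size_poly0 size_polyX.
  rewrite size_denom ltnS.
  rewrite numer_cons denom_cons.
  have -> : 'X * (('X - (ynode a)%:P) * numer l) - ('X - (xnode a)%:P) * denom l =
     ('X - (xnode a)%:P) * ('X * numer l - denom l)
       + (xnode a - ynode a)%:P * ('X * numer l).
    by rewrite rmorphB /=; ring.
  rewrite (leq_trans (size_polyD _ _)) // geq_max; apply/andP; split.
    have [->|n0] := eqVneq ('X * numer l - denom l) 0.
      by rewrite mulr0 size_poly0.
    rewrite size_monicM ?monicXsubC // size_XsubC.
    by move: IH; rewrite size_denom.
  rewrite mul_polyC (leq_trans (size_scale_leq _ _)) //.
  by rewrite mulrC size_mulX ?size_numer // -size_poly_eq0 size_numer.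
rewrite coefB mulrC.
rewrite /denom -[X in _ - _`_X](_ : (size (map xnode (rcons l 0%N))).-1 = _);
  last first.
  by rewrite size_map size_rcons.
rewrite coefPn_prod_XsubC ?size_map ?size_rcons // opprK big_map.
rewrite coefMX; case: l => [|a l]; first by rewrite /= big_seq1 /xnode add0r.
have: size (a :: l) != 0%N by []; move: (a :: l) => l' l0; rewrite (negbTE l0).
have -> : (numer l')`_(size l').-1 = - \sum_(m <- l') ynode m.
  rewrite /numer -(big_map ynode xpredT (fun c => 'X - c%:P)).
  by rewrite -(size_map ynode) coefPn_prod_XsubC ?size_map // big_map.
rewrite -cats1 big_cat big_seq1 /= [xnode 0]/(0%:R) addr0 addrC -sumrB.
elim: l' {l0} => [|b l' IH]; first by rewrite big_nil.
rewrite big_cons IH /= natrD; congr (_ + _).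
by rewrite xnodeE ynodeE; field.
Qed.

(** Multiplying [numer_denom_incr] by X^k and expanding both quadratic factors gives a linear
    relation between moments. *)
Lemma mom_incr k l i (z := xnode (nth 0%N l i)) (l' := incr_nth l i) :
  (i <= size l)%N ->
  mom k.+2 l' - (2 * z + 1) * mom k.+1 l' + z * (z - 1) * mom k l' =
  mom k.+2 l - 2 * z * mom k.+1 l + z ^+ 2 * mom k l.
Proof.
move=> il.
have E u v (p : seq nat) : mom k.+2 p - u * mom k.+1 p + v * mom k p =
   residue (denom p) ('X^k * ('X^2 - u *: 'X + v%:P) * numer p).
  rewrite /mom -mulNr -!residueZ -!residueD; congr residue.
  by rewrite -!mul_polyC rmorphN /= !exprS; ring.
rewrite !E; apply: eq_residue; rewrite ?denom_monic ?size_denom //.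
have -> : 'X^2 - (2 * z + 1) *: 'X + (z * (z - 1))%:P =
   ('X - (ynode (nth 0 l i))%:P) * ('X - (xnode (nth 0 l i).+1)%:P) :> {poly R}.
  by rewrite -node_prod -node_sum -mul_polyC rmorphD rmorphM /=; ring.
have -> : 'X^2 - (2 * z) *: 'X + (z ^+ 2)%:P = ('X - z%:P) ^+ 2 :> {poly R}.
  by rewrite -mul_polyC !expr2 !polyCM polyC_natr; ring.
have := numer_denom_incr il; rewrite -/l' -/z => e.
transitivity ('X^k * (numer l' * denom l *
  (('X - (ynode (nth 0 l i))%:P) * ('X - (xnode (nth 0 l i).+1)%:P)))); first by ring.
by rewrite e; ring.
Qed.

End Moments.

(** * The weight filtration and the averaging operator *)

Lemma all_incr_nth (p : pred nat) l i : (i <= size l)%N -> all p l ->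
  all p (incr_nth l i) = p (nth 0%N l i).+1.
Proof.
elim: l i => [|a l IH] [|i] //= il; first by rewrite andbT.
  by case/andP=> _ ->; rewrite andbT.
by case/andP=> -> pl; rewrite IH.
Qed.

(** Only a part equal to the new length obstructs growth. In this form [weight_eq0] finds a root of
    [numer]. *)
Lemma is_strict_incr l i : is_strict l -> (i <= size l)%N ->
  is_strict (incr_nth l i) = ((nth 0%N l i).+1 \notin l).
Proof.
elim: l i => [|a l IH] [|i] // + il; rewrite !is_strict_cons => /and3P[a0 al sl].
  rewrite sl andbT /= inE; have /negbTE-> : a.+1 != a by rewrite gtn_eqF.
  apply/esym; move/allP: al => al; have -> : all (fun b => b < a.+1)%N l.
    by apply/allP => b /al; lia.
  by apply/negP => /al; lia.
rewrite /= in il *; rewrite a0 /= all_incr_nth // IH // inE negb_or; congr (_ && _).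
have : (nth 0%N l i < a)%N.
  have [lt|ge] := ltnP i (size l); last by rewrite nth_default.
  by apply: (allP al); rewrite mem_nth.
by lia.
Qed.

Lemma sumn_incr_nth l i : (i <= size l)%N -> sumn (incr_nth l i) = (sumn l).+1.
Proof.
elim: l i => [|a l IH] [|i] //= il.
by rewrite IH // addnS.
Qed.

Section Filtration.
Variable R : numFieldType.
Implicit Types (l : seq nat) (i k d : nat) (f g : seq nat -> R).
Local Notation mom := (@mom R).
Local Notation xnode := (@xnode R).
Local Notation weight := (@weight R).

(** If m + 1 is a part, the zero y_(m+1) = x_m of A cancels the pole of row i. *)
Lemma weight_eq0 l i : is_strict l -> (i <= size l)%N ->
  ~~ is_strict (incr_nth l i) -> weight l i = 0.
Proof.
move=> sl il; rewrite is_strict_incr // negbK => ml.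
rewrite /weight; have -> : (numer R l).[xnode (nth 0%N l i)] = 0; last by rewrite mul0r.
apply/eqP; rewrite -/(root _ _) /numer -(big_map (@ynode R) xpredT (fun c
  => 'X - c%:P)).
by rewrite root_prod_XsubC; apply/mapP; exists (nth 0%N l i).+1.
Qed.

(* The boxes in a row of length m have contents 1, ..., m, so the coefficients
   are the elementary symmetric functions of the binom(c, 2). *)
Definition content_poly l : {poly R} :=
  \prod_(m <- l) \prod_(1 <= c < m.+1) (1 + 'C(c, 2)%:R *: 'X).

(** The new box has content m + 1 and so contributes binom(m + 1, 2) = x_m. *)
Lemma content_poly_incr l i : (i <= size l)%N ->
  content_poly (incr_nth l i) = content_poly l * (1 + xnode (nth 0%N l i) *: 'X).
Proof.
rewrite /content_poly; elim: l i => [|a l IH] [|i] // il.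
- by rewrite big_seq1 big_nil big_nat1 mul1r.
- rewrite [incr_nth _ _]/= [nth _ _ _]/= [LHS]big_cons [in RHS]big_cons.
  by rewrite (big_nat_recr a.+1) // mulrAC.
- by rewrite [incr_nth _ _]/= !big_cons IH // mulrA.
Qed.

(* [filt d f]: f has weight < d, so that [filt 0] consists of the functions
   vanishing on strict partitions. *)
Inductive filt : nat -> (seq nat -> R) -> Prop :=
| filt0 : filt 0 (fun=> 0)
| filt_cst c : filt 1 (fun=> c)
| filt_mom k : filt k.+1 (mom k)
| filt_content k : filt k.*2.+1 (fun l => (content_poly l)`_k)
| filtD d f g : filt d f -> filt d g -> filt d (fun l => f l + g l)
| filtM a b f g : filt a.+1 f -> filt b.+1 g -> filt (a + b).+1 (fun l => f l * g l)
| filt_le a b f : (a <= b)%N -> filt a f -> filt b f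
| filt_ext d f g : (forall l, is_strict l -> f l = g l) -> filt d f -> filt d g.

(* Polynomials in one more variable z, of weight 1, over the filtered ring. *)
Inductive filt2 : nat -> (seq nat -> R -> R) -> Prop :=
| filt2_filt d f : filt d f -> filt2 d (fun l _ => f l)
| filt2X d G : filt2 d G -> filt2 d.+1 (fun l z => z * G l z)
| filt2D d G H : filt2 d G -> filt2 d H -> filt2 d (fun l z => G l z + H l z)
| filt2_le a b G : (a <= b)%N -> filt2 a G -> filt2 b G
| filt2_ext d G H : (forall l z, is_strict l -> G l z = H l z) ->
    filt2 d G -> filt2 d H.

Lemma filt_zero d f : (forall l, is_strict l -> f l = 0) -> filt d f.
Proof.
by move=> f0; apply: (filt_ext _ (filt_le (leq0n d) filt0)) => l /f0.
Qed.

Lemma filt2_zero d G : (forall l z, is_strict l -> G l z = 0) -> filt2 d G.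
Proof.
move=> G0; apply: (filt2_ext _ (filt2_le (leq0n d) (filt2_filt filt0))) => l z sl.
by rewrite G0.
Qed.

(** Ends the descent of U - 1: the rules that can reach level 0 keep functions zero on strict
    partitions. *)
Lemma filt_eq0 f l : filt 0 f -> is_strict l -> f l = 0.
Proof.
move=> fl; suff: forall d g, filt d g -> d = 0%N -> forall l, is_strict l -> g l = 0.
  by move/(_ 0%N f fl); apply.
move=> {l f fl} d f; elim=> //.
- by move=> {}d {}f g _ IHf _ IHg d0 l sl; rewrite IHf // IHg // addr0.
- by move=> a b {}f ab _ IH b0; apply: IH; move: ab; rewrite b0 leqn0 => /eqP.
- by move=> {}d {}f g fg _ IH d0 l sl; rewrite -fg // IH.
Qed.

Lemma filt2_mull a b f G : filt a.+1 f -> filt2 b G ->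
  filt2 (a + b) (fun l z => f l * G l z).
Proof.
move=> ff; elim=> {b G}.
- move=> [|b] g fg; last by rewrite addnS; apply/filt2_filt/filtM.
  (* Level 0 is out of reach of [filtM], but f vanishes there. *)
  by apply: filt2_zero => l _ sl; rewrite (filt_eq0 fg sl) mulr0.
- move=> b G _ IH; rewrite addnS.
  by apply: (filt2_ext _ (filt2X IH)) => l z _; rewrite mulrCA.
- move=> b G H _ IG _ IH.
  by apply: (filt2_ext _ (filt2D IG IH)) => l z _; rewrite mulrDr.
- by move=> b c G bc _; apply: filt2_le; rewrite leq_add2l.
- by move=> b G H GH _; apply: filt2_ext => l z sl; rewrite GH.
Qed.

Lemma filt2Z c d G : filt2 d G -> filt2 d (fun l z => c * G l z).
Proof. by move=> FG; have := filt2_mull (filt_cst c) FG. Qed.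

Lemma filt2M a b G H : filt2 a G -> filt2 b H ->
  filt2 (a + b) (fun l z => G l z * H l z).
Proof.
move=> + FH; elim=> {a G}.
- move=> [|a] f ff.
    by apply: filt2_zero => l z sl; rewrite (filt_eq0 ff sl) mul0r.
  by apply: filt2_le (filt2_mull ff FH); rewrite leq_add2r.
- move=> a G _ IG; rewrite addSn.
  by apply: (filt2_ext _ (filt2X IG)) => l z _; rewrite mulrA.
- move=> a G G' _ IG _ IG'.
  by apply: (filt2_ext _ (filt2D IG IG')) => l z _; rewrite mulrDl.
- by move=> a c G ac _; apply: filt2_le; rewrite leq_add2r.
- by move=> a G G' GG' _; apply: filt2_ext => l z sl; rewrite GG'.
Qed.

(** The change of f when a box is added is a polynomial in the node x_m; below, d is one less than
    the level of f. *)
Definition has_increment d f := exists2 G, filt2 d G &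
  forall l i, is_strict l -> (i <= size l)%N ->
    is_strict (incr_nth l i) ->
    f (incr_nth l i) = f l + G l (xnode (nth 0%N l i)).

(** The recurrence [mom_incr] has two steps, so the induction carries two consecutive moments. *)
Lemma mom_increment k : has_increment k (mom k).
Proof.
suff: has_increment k (mom k) /\ has_increment k.+1 (mom k.+1) by case.
elim: k => [|k [[G0 FG0 E0] [G1 FG1 E1]]]; split.
- exists (fun _ _ => 0); first exact: filt2_zero.
  by move=> l i _ _ _; rewrite !mom0 addr0.
- exists (fun _ _ => 1); first exact/filt2_filt/filt_cst.
  by move=> l i _ il _; rewrite !mom1 sumn_incr_nth // natr1.
- by exists G1.
(* [mom_incr] solved for the increment of M_(k+2). The terms 2 z M_(k+1) and z^2 M_k, whose weight
   is too large, cancel. *)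
exists (fun l z => z * (2 * G1 l z) + G1 l z + z * (z * (-1 * G0 l z)) + z * G0 l z
                   + mom k.+1 l + z * mom k l).
  apply: filt2D; last exact/filt2X/filt2_filt/filt_mom.
  apply: filt2D; last exact/filt2_filt/filt_mom.
  apply: filt2D; last by apply: (filt2_le _ (filt2X FG0)).
  apply: filt2D; last exact/filt2X/filt2X/filt2Z.
  apply: filt2D; last exact: filt2_le FG1.
  exact/filt2X/filt2Z.
move=> l i sl il sl'; have := mom_incr R k il; rewrite E0 // E1 //.
set z := xnode _; set X := mom k.+2 _ => e.
have -> : X = (X - (2 * z + 1) * (mom k.+1 l + G1 l z) + z * (z - 1) * (mom k l
  + G0 l z))
   + (2 * z + 1) * (mom k.+1 l + G1 l z) - z * (z - 1) * (mom k l + G0 l z) by ring.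
by rewrite e; ring.
Qed.

Lemma filt_increment d f : filt d f -> has_increment d.-1 f.
Proof.
elim=> {d f}.
- by exists (fun _ _ => 0); [exact: filt2_zero | move=> l i _ _ _; rewrite addr0].
- by move=> c; exists (fun _ _ => 0); [exact: filt2_zero | move=> l i _ _ _;
  rewrite addr0].
- exact: mom_increment.
- move=> [|k].
    exists (fun _ _ => 0); first exact: filt2_zero.
    move=> l i _ il _; rewrite content_poly_incr // mulrDr mulr1 coefD -scalerAr coefZ.
    by rewrite coefMX /= mulr0.
  (* e_(k+1) grows by x_m e_k, of weight 2 k + 1. *)
  exists (fun l z => z * (content_poly l)`_k).
    by apply: filt2_le (filt2X (filt2_filt (filt_content k))); rewrite doubleS.
  move=> l i _ il _; rewrite content_poly_incr // mulrDr mulr1 coefD -scalerAr coefZ.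
  by rewrite coefMX.
- move=> d f g _ [F FF Ef] _ [G FG Eg].
  exists (fun l z => F l z + G l z); first exact: filt2D.
  by move=> l i sl il sl'; rewrite Ef // Eg // addrACA.
- move=> a b f g ff [F FF Ef] fg [G FG Eg].
  (* Discrete Leibniz rule. *)
  exists (fun l z => f l * G l z + g l * F l z + F l z * G l z).
    apply: filt2D (filt2M FF FG); apply: filt2D (filt2_mull ff FG) _.
    by rewrite /= addnC; apply: filt2_mull.
  by move=> l i sl il sl'; rewrite Ef // Eg //; ring.
- move=> a b f ab _ [G FG E]; exists G => //; apply: filt2_le FG.
  by rewrite -!subn1 leq_sub2r.
- move=> d f g fg _ [G FG E]; exists G => // l i sl il sl'.
  by rewrite -!fg // E.
Qed.

(** The operator U; rows that cannot grow are included, with weight 0. *)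
Definition step f l : R := \sum_(i < (size l).+1) weight l i * f (incr_nth l i).

(** By [mom_sum], averaging x_m^k produces M_k, of the same weight. The exponent k collects the
    powers of z that the induction strips off G. *)
Lemma filt_average d G k : filt2 d G -> filt (d + k) (fun l =>
  \sum_(i < (size l).+1)
     weight l i * (xnode (nth 0%N l i) ^+ k * G l (xnode (nth 0%N l i)))).
Proof.
move=> FG; elim: FG k => {d G}.
- move=> [|d] f ff k.
    apply: filt_zero => l sl; rewrite big1 // => i _.
    by rewrite (filt_eq0 ff sl) !mulr0.
  rewrite addSn; apply: (filt_ext _ (filtM ff (filt_mom k))) => l sl.
  by rewrite mom_sum // mulr_sumr; apply: eq_bigr => i _; ring.
- move=> d G _ IH k; rewrite addSnnS; apply: (filt_ext _ (IH k.+1)) => l sl.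
  by apply: eq_bigr => i _; rewrite exprSr !mulrA.
- move=> d G H _ IG _ IH k; apply: (filt_ext _ (filtD (IG k) (IH k))) => l sl.
  by rewrite -big_split; apply: eq_bigr => i _; rewrite /= -!mulrDr.
- by move=> a b G ab _ IH k; apply: filt_le (IH k); rewrite leq_add2r.
- move=> d G H GH _ IH k; apply: (filt_ext _ (IH k)) => l sl.
  by apply: eq_bigr => i _; rewrite GH.
Qed.

(** The weights sum to 1, so U f - f is the average of the increment of f. *)
Lemma step_filt d f : filt d f ->
  exists2 g, filt d.-1 g & forall l, is_strict l -> step f l = f l + g l.
Proof.
move=> /filt_increment[G /(filt_average 0) FG E]; rewrite addn0 in FG.
eexists; first exact: FG; move=> l sl; rewrite -[f l]mulr1 -(mom0 R l) mom_sum //.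
rewrite mulr_sumr -big_split; apply: eq_bigr => i _ /=.
have il : (i <= size l)%N by rewrite -ltnS.
rewrite !expr0 mulr1 mul1r [f l * _]mulrC -mulrDr.
have [sl'|ns] := boolP (is_strict (incr_nth l i)); last by rewrite weight_eq0 ?mul0r.
by rewrite -E.
Qed.

Lemma eq_step f g l : is_strict l -> (forall l, is_strict l -> f l = g l) ->
  step f l = step g l.
Proof.
move=> sl fg; apply: eq_bigr => i _.
have [/fg->//|ns] := boolP (is_strict (incr_nth l i)).
by rewrite weight_eq0 ?mul0r // -ltnS.
Qed.

Lemma eq_iter_step n f g l : is_strict l -> (forall l, is_strict l -> f l = g l) ->
  iter n step f l = iter n step g l.
Proof.
move=> sl fg; elim: n l sl => [|n IH] l sl /=; first exact: fg.
exact: eq_step.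
Qed.

Lemma iter_stepD n f g l : iter n step (fun l => f l + g l) l =
  iter n step f l + iter n step g l.
Proof.
elim: n l => //= n IH l; rewrite /step -big_split; apply: eq_bigr => i _.
by rewrite IH mulrDr.
Qed.

(** U^n = sum_k binom(n, k) (U - 1)^k, where (U - 1)^d f vanishes on strict partitions. *)
Lemma iter_step_filt d f l : filt d f -> is_strict l ->
  exists a : nat -> R, forall n, iter n step f l = \sum_(k < d) a k * 'C(n, k)%:R.
Proof.
elim: d f => [|d IH] f ff sl.
  exists (fun=> 0) => n; rewrite big_ord0.
  have /(eq_iter_step n sl)-> : forall l, is_strict l -> f l = 0.
    by move=> {}l {}sl; apply: filt_eq0.
  elim: n l {sl} => //= n IH l; rewrite /step big1 // => i _; first by rewrite IH mulr0.
have [g fg E] := step_filt ff; have [a Ea] := IH g fg sl.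
(* a k stands for ((U - 1)^k f)(l), and g = (U - 1) f. *)
exists (fun k => if k is k'.+1 then a k' else f l); elim=> [|n IHn].
  rewrite big_ord_recl big1 => [|i _]; first by rewrite mulr1 addr0.
  by rewrite /= mulr0.
(* U^(n+1) f = U^n f + U^n g; Pascal's rule then merges the two sums. *)
rewrite iterSr (eq_iter_step n sl E) iter_stepD IHn Ea.
rewrite !big_ord_recl /= !bin0 -addrA; congr (_ + _).
by rewrite -big_split; apply: eq_bigr => k _; rewrite /= binS natrD mulrDr.
Qed.

End Filtration.

(** * Hook lengths and the transition weights *)

Lemma is_strict_nth l s t : is_strict l -> (s <= t < size l)%N ->
  (nth 0 l t + (t - s) <= nth 0 l s)%N.
Proof.
elim: l s t => [|a l IH] s t; first by rewrite ltn0 andbF.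
rewrite is_strict_cons => /and3P[a0 al sl]; case: s t => [|s] [|t] //=.
- by rewrite addn0.
- rewrite ltnS => tl; have lt : (nth 0 l 0 < a)%N.
    by apply: (allP al); rewrite mem_nth // (leq_ltn_trans _ tl).
  by have := IH 0%N t sl tl; lia.
- by rewrite !ltnS subSS; apply: IH.
Qed.

Lemma is_strict_nth_size l s : is_strict l -> (s < size l)%N ->
  (size l <= nth 0 l s + s)%N.
Proof.
move=> sl lt.
have lt' : ((size l).-1 < size l)%N by rewrite prednK // (leq_ltn_trans _ lt).
have := is_strict_nth sl (_ : (s <= (size l).-1 < size l)%N).
have : (0 < nth 0 l (size l).-1)%N.
  by move: sl => /andP[_ /allP]; apply; rewrite mem_nth.
by move=> p /(_ _)-h; have := h ltac:(lia); lia.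
Qed.

Lemma count_eq0 (T : eqType) (p : pred T) (s : seq T) :
  {in s, forall x, ~~ p x} -> count p s = 0%N.
Proof.
by move=> ps; apply/eqP; rewrite -leqn0 leqNgt -has_count; apply/hasPn.
Qed.

(** Each row starts one column further right, so the tail is shifted by (1, 1). *)
Lemma boxes_cons a l : boxes (a :: l) =
  [seq (1%N, j) | j <- iota 2 a] ++ [seq (b.1.+1, b.2.+1) | b <- boxes l].
Proof.
rewrite /boxes /= map_flatten -map_comp; congr (_ ++ flatten _).
rewrite -[2%N]/(1 + 1)%N iotaDl -map_comp; apply/eq_in_map => i.
rewrite mem_iota /= => /andP[i0 _]; rewrite -map_comp.
case: i i0 => // i _; rewrite add1n -[i.+3]/(1 + i.+2)%N iotaDl -map_comp.
exact: eq_map.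
Qed.

Lemma boxes_gt b l : b \in boxes l -> (0 < b.1 < b.2)%N.
Proof.
case/flatten_mapP => i; rewrite mem_iota => /andP[i0 _] /mapP[j].
by rewrite mem_iota => /andP[ij _] -> /=; rewrite i0.
Qed.

Lemma hook_cons_tail a l b : b \in boxes l ->
  hook (a :: l) (b.1.+1, b.2.+1) = hook l b.
Proof.
case: b => i j /boxes_gt /= /andP[i0 ij];
  rewrite /hook boxes_cons !count_cat !count_map /=.
rewrite [X in (X + _ + _ + _ + _)%N]count_eq0; last by move=> k _ /=; lia.
rewrite [X in (_ + (X + _) + _ + _)%N]count_eq0; last by move=> k _ /=; lia.
by rewrite !add0n; congr (_ + _ + _ + _)%N; case: j ij.
Qed.

Lemma Hprod_cons a l :
  Hprod (a :: l) = (\prod_(k <- iota 0 a) hook (a :: l) (1, k.+2) * Hprod l)%N.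
Proof.
rewrite /Hprod boxes_cons big_cat !big_map /=; congr (_ * _)%N.
  by rewrite -[2%N]/(2 + 0)%N iotaDl big_map.
rewrite big_seq [RHS]big_seq; apply: eq_bigr => b; exact: hook_cons_tail.
Qed.

Lemma count_boxes_col l j :
  count (fun b => b.2 == j) (boxes l) =
  count (fun t => t.+1 < j <= t.+1 + nth 0 l t)%N (iota 0 (size l)).
Proof.
elim: l j => // a l IH j; rewrite boxes_cons count_cat !count_map /=.
congr (_ + _)%N.
  rewrite -[LHS]/(count_mem j (iota 2 a)) count_uniq_mem ?iota_uniq // mem_iota.
  by congr (nat_of_bool _); rewrite nth0 /=; lia.
rewrite -[1%N]/(1 + 0)%N iotaDl count_map.
case: j => [|j]; first by rewrite !count_eq0.
rewrite -[LHS]/(count (fun b => b.2 == j) (boxes l)) IH.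
by apply: eq_count => t /=; rewrite add1n.
Qed.

(** Arm plus one, then leg, then the part lambda_(k+2), which is [nth 0 l k]. *)
Lemma hook_head a l k : (k < a)%N ->
  hook (a :: l) (1%N, k.+2) =
  (a - k + count (fun t => t < k <= t + nth 0 l t) (iota 0 (size l)) + nth 0 l k)%N.
Proof.
move=> ka; rewrite /hook boxes_cons !count_cat !count_map.
have -> : count (preim (fun b => (b.1.+1, b.2.+1))
  (fun b => (b.1 == 1) && (k.+2 < b.2)))%N (boxes l) = 0%N.
  apply: count_eq0 => b /boxes_gt /=; lia.
have -> : count (preim (fun j => (1%N, j))
  (fun b => (b.2 == k.+2) && (1 < b.1)))%N (iota 2 a) = 0%N.
  by apply: count_eq0 => b _ /=; rewrite andbF.
have -> : count (preim (fun b => (b.1.+1, b.2.+1))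
  (fun b => (b.2 == k.+2) && (1 < b.1)))%N (boxes l) =
  count (fun b => b.2 == k.+1) (boxes l).
  by apply: eq_in_count => b /boxes_gt /=; rewrite eqSS; lia.
rewrite count_boxes_col addn0 add0n /=.
have -> : count (preim (fun j => (1%N, j))
  (fun b => (b.1 == 1) && (k.+2 < b.2)))%N (iota 2 a) = (a - k.+1)%N.
  have -> : iota 2 a = iota 2 k.+1 ++ iota k.+3 (a - k.+1).
    by rewrite -iotaD subnKC.
  rewrite count_cat [X in (X + _)%N](_ : _ = 0%N); last first.
    apply: count_eq0 => j; rewrite mem_iota /=; lia.
  rewrite -[RHS](size_iota k.+3) -[RHS]count_predT.
  by apply: eq_in_count => j; rewrite mem_iota /=; lia.
rewrite (@eq_count _ _ (fun t => t < k <= t + nth 0 l t)%N) //.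
lia.
Qed.

(** * Hook lengths in the first row *)

Section HookRow.
Variables (a : nat) (l : seq nat).
Hypothesis sal : is_strict (a :: l).

Let sl : is_strict l. Proof. by move: sal; rewrite is_strict_cons => /and3P[]. Qed.
Let a_gt t : (nth 0 l t < a)%N.
Proof.
move: sal; rewrite is_strict_cons => /and3P[a0 /allP al _].
by have [lt|ge] := ltnP t (size l); [apply/al/mem_nth | rewrite nth_default].
Qed.
Let size_a : (size l < a)%N.
Proof. by have := is_strict_nth_size sal (ltn0Sn _); rewrite /= addn0. Qed.

(** The first k rows of [l] all reach this column, so the leg k compensates the k missing from the
    arm. *)
Lemma hook_head_lt k : (k < size l)%N -> hook (a :: l) (1%N, k.+2) = (a + nth 0 l k)%N.
Proof.
move=> kl; rewrite hook_head ?(ltn_trans kl) //.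
have -> : count (fun t => t < k <= t + nth 0 l t)%N (iota 0 (size l)) = k; last by lia.
rewrite -(subnKC (ltnW kl)) iotaD count_cat [X in (_ + X)%N](_ : _ = 0%N); last first.
  apply: count_eq0 => j; rewrite mem_iota /=; lia.
rewrite addn0 -[RHS](size_iota 0) -[RHS]count_predT.
apply: eq_in_count => t; rewrite mem_iota /= => tk.
have tl : (t < size l)%N by lia.
by have := is_strict_nth_size sl tl; lia.
Qed.

Let c k := count (fun t => k <= t + nth 0 l t)%N (iota 0 (size l)).

Lemma hook_head_ge k : (size l <= k < a)%N ->
  hook (a :: l) (1%N, k.+2) = (a - k + c k)%N.
Proof.
move=> /andP[lk ka]; rewrite hook_head // [nth _ _ _]nth_default // addn0; congr (_
  + _)%N.
by apply: eq_in_count => t; rewrite mem_iota => /andP[_ tl]; lia.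
Qed.

(** t + l_t is nonincreasing, so the rows counted by [c k] form an initial segment; likewise for
    [c_le]. *)
Let c_gt k t : (t < size l)%N -> (k <= t + nth 0 l t)%N -> (t < c k)%N.
Proof.
move=> tl kt; rewrite /c -(subnKC tl) iotaD count_cat.
rewrite [X in (X + _)%N](_ : _ = t.+1) ?leq_addr //.
rewrite -[RHS](size_iota 0) -[RHS]count_predT.
apply: eq_in_count => s; rewrite mem_iota /= => st.
have st' : (s <= t < size l)%N by lia.
by have := is_strict_nth sl st'; lia.
Qed.

Let c_le k t : (t < size l)%N -> (t + nth 0 l t < k)%N -> (c k <= t)%N.
Proof.
move=> tl kt; rewrite /c -(subnKC (ltnW tl)) iotaD count_cat.
rewrite [X in (_ + X)%N](_ : _ = 0%N) ?addn0.
  by rewrite -[X in (_ <= X)%N](size_iota 0) count_size.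
apply: count_eq0 => s; rewrite mem_iota /= => h.
have st' : (t <= s < size l)%N by lia.
by have := is_strict_nth sl st'; lia.
Qed.

(* Beyond column size l the hooks of the first row and the differences
   a - b (b a lower part) together are exactly 1, ..., a. *)
Lemma perm_hook_head :
  perm_eq ([seq (a - k + c k)%N | k <- iota (size l) (a - size l)] ++
    [seq (a - b)%N | b <- l])
          (iota 1 a).
Proof.
have c_mono k k' : (k <= k')%N -> (c k' <= c k)%N.
  by move=> kk; apply: sub_count => t /=; lia.
have c_size k : (c k <= size l)%N by rewrite -[X in (_ <= X)%N](size_iota 0) count_size.
have nthP' b : b \in l -> exists2 t, (t < size l)%N & b = nth 0 l t.
  by move=> bl; exists (index b l); rewrite ?index_mem ?nth_index.
have u : uniq ([seq (a - k + c k)%N | k <- iota (size l) (a - size l)] ++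
  [seq (a - b)%N | b <- l]).
  rewrite cat_uniq; apply/and3P; split.
  - rewrite map_inj_in_uniq ?iota_uniq // => k k'; rewrite !mem_iota => hk hk' e.
    by case: (ltngtP k k') => // h; have := c_mono _ _ (ltnW h); lia.
  (* A common value would mean k = c k + l_t; but c k > t if k <= t + l_t, and c k <= t
     otherwise. *)
  - apply/hasPn => _ /mapP[b /nthP'[t tl ->] ->]; apply/mapP => -[k].
    rewrite mem_iota => hk e; have := a_gt t.
    by have [h|h] := leqP k (t + nth 0 l t); [have := c_gt tl h | have := c_le tl h];
      lia.
  - rewrite map_inj_in_uniq => [|b b' /nthP'[t _ ->] /nthP'[t' _ ->]].
      by have := is_strict_uniq sl; rewrite rcons_uniq => /andP[].
    by move=> /= e; rewrite -(subKn (ltnW (a_gt t))) e subKn // ltnW.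
have sub : {subset [seq (a - k + c k)%N | k <- iota (size l) (a - size l)] ++
  [seq (a - b)%N | b <- l] <= iota 1 a}.
  move=> x; rewrite mem_cat mem_iota => /orP[]/mapP[].
    by move=> k; rewrite mem_iota => hk ->; have := c_size k; lia.
  by move=> b /nthP'[t tl ->] ->; rewrite subn_gt0 a_gt ltnS leq_subr.
have [|_ e] := uniq_min_size u sub; last by apply: uniq_perm; rewrite ?iota_uniq.
by rewrite size_cat !size_map !size_iota subnK // ltnW.
Qed.

Lemma prod_hook_head :
  (\prod_(k <- iota 0 a) hook (a :: l) (1, k.+2) * \prod_(b <- l) (a - b) =
   a`! * \prod_(b <- l) (a + b))%N.
Proof.
have -> : iota 0 a = iota 0 (size l) ++ iota (size l) (a - size l).
  by rewrite -[in RHS](add0n (size l)) -iotaD subnKC // ltnW.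
rewrite big_cat /= -mulnA mulnC; congr (_ * _)%N; last first.
  rewrite [RHS](big_nth 0%N) /index_iota subn0 big_seq [RHS]big_seq.
  by apply: eq_bigr => k; rewrite mem_iota /= add0n => /hook_head_lt.
rewrite fact_prod /index_iota subSS subn0 -(perm_big _ perm_hook_head) /=
  big_cat !big_map /=.
congr (_ * _)%N; rewrite big_seq [RHS]big_seq; apply: eq_bigr => k.
by rewrite mem_iota => hk; apply: hook_head_ge; have := size_a; lia.
Qed.

End HookRow.

(** One step of the product formula H = prod_i lambda_i! prod_(i<j) (lambda_i + lambda_j) /
    (lambda_i - lambda_j), cleared of denominators. *)
Lemma Hprod_cons_prod a l : is_strict (a :: l) ->
  (Hprod (a :: l) * \prod_(b <- l) (a - b) = a`! * \prod_(b <- l) (a + b) * Hprod l)%N.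
Proof. by move=> sal; rewrite Hprod_cons mulnAC prod_hook_head. Qed.

Lemma size_le_sumn l : is_strict l -> (size l <= sumn l)%N.
Proof. by elim: l => //= a l IH; rewrite is_strict_cons => /and3P[a0 _ /IH]; lia. Qed.

Lemma prod_incr_nth (R : comPzSemiRingType) (phi : nat -> R) l i :
    phi 0%N = 1 -> (i <= size l)%N ->
  (\prod_(b <- incr_nth l i) phi b) * phi (nth 0%N l i) =
  (\prod_(b <- l) phi b) * phi (nth 0%N l i).+1.
Proof.
move=> phi0; elim: l i => [|a l IH] [|i] //= il.
- by rewrite big_seq1 big_nil phi0 mulr1 mul1r.
- by rewrite !big_cons [LHS]mulrC mulrA mulrAC.
- by rewrite !big_cons -!mulrA IH.
Qed.

(** * The function F and its growth ratios *)

Section Plancherel.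
Variable R : numFieldType.

(** F in product form, whose ratios under adding a box are explicit; [planchE] relates it to
    hooks. *)
Fixpoint planch (l : seq nat) : R := if l is a :: l' then
  2 ^+ a.-1 / a`!%:R * (\prod_(b <- l') ((a%:R - b%:R) / (a%:R + b%:R))) * planch l'
  else 1.

Lemma Hprod_gt0 l : (0 < Hprod l)%N.
Proof.
rewrite /Hprod; apply: (big_ind (fun n => 0 < n)%N) => // [m n m0|[i j] _].
  by rewrite muln_gt0 m0.
by rewrite /hook addn1.
Qed.

Lemma planchE l : is_strict l -> planch l = 2 ^+ (sumn l - size l) / (Hprod l)%:R.
Proof.
elim: l => [|a l IH] sal; first by rewrite /Hprod /boxes /= big_nil divr1.
have := congr1 (fun n : nat => n%:R : R) (Hprod_cons_prod sal).
have := sal; rewrite is_strict_cons => /and3P[a0 /allP al sl].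
have sz := size_le_sumn sl.
have -> : 2 ^+ (sumn (a :: l) - size (a :: l)) =
  2 ^+ a.-1 * 2 ^+ (sumn l - size l) :> R.
  by rewrite -exprD; congr (_ ^+ _); rewrite /=; lia.
rewrite /= IH // prodf_div !natrM !(@natr_prod _ _ l).
have -> : \prod_(b <- l) (a - b)%:R = \prod_(b <- l) (a%:R - b%:R) :> R.
  by rewrite big_seq [RHS]big_seq; apply: eq_bigr => b /al lt; rewrite natrB // ltnW.
have -> : \prod_(b <- l) (a + b)%:R = \prod_(b <- l) (a%:R + b%:R) :> R.
  by apply: eq_bigr => b _; rewrite natrD.
set D := \prod_(b <- l) (_ - _); set S := \prod_(b <- l) (_ + _) => e.
have S0 : S != 0.
  rewrite prodf_seq_neq0; apply/allP => b _ /=.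
  by rewrite -natrD pnatr_eq0 -lt0n addn_gt0 a0.
have H0 : (Hprod (a :: l))%:R != 0 :> R by rewrite pnatr_eq0 -lt0n Hprod_gt0.
have H'0 : (Hprod l)%:R != 0 :> R by rewrite pnatr_eq0 -lt0n Hprod_gt0.
have f0 : a`!%:R != 0 :> R by rewrite pnatr_eq0 -lt0n fact_gt0.
have -> : D = a`!%:R * S * (Hprod l)%:R / (Hprod (a :: l))%:R by rewrite -e mulrC mulKf.
by field; rewrite H0 S0 H'0.
Qed.

Lemma denom_root l i : (i <= size l)%N -> (denom R l).[xnode R (nth 0%N l i)] = 0.
Proof.
move=> il; apply/eqP; rewrite -/(root _ _) /denom root_prod_XsubC map_f //.
have [lt|ge] := ltnP i (size l); first by rewrite mem_rcons inE mem_nth ?orbT.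
by rewrite nth_default // mem_rcons inE eqxx.
Qed.

Lemma weight_head a l : weight R (a :: l) 0 =
  (xnode R a - ynode R a) / xnode R a *
  \prod_(b <- l) ((xnode R a - ynode R b) / (xnode R a - xnode R b)).
Proof.
have dE : (denom R l).[xnode R a] = xnode R a * \prod_(b <- l) (xnode R a - xnode R b).
  elim: l => [|b l IH]; first by rewrite denom_nil hornerX big_nil mulr1.
  by rewrite denom_cons hornerM hornerXsubC IH big_cons mulrCA.
have nE : (numer R l).[xnode R a] = \prod_(b <- l) (xnode R a - ynode R b).
  by rewrite /numer horner_prod; apply: eq_bigr => b _; rewrite hornerXsubC.
rewrite /weight /= numer_cons denom_cons derivM derivXsubC mul1r hornerD !hornerM
  !hornerXsubC.
by rewrite subrr mul0r addr0 dE nE prodf_div invfM; ring.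
Qed.

Lemma weight_tail a l i : (i <= size l)%N -> weight R (a :: l) i.+1 =
  (xnode R (nth 0%N l i) - ynode R a) / (xnode R (nth 0%N l i) - xnode R a)
    * weight R l i.
Proof.
move=> il; rewrite /weight /= numer_cons denom_cons derivM derivXsubC mul1r hornerD
  !hornerM.
by rewrite !hornerXsubC denom_root // add0r invfM; ring.
Qed.

(** With [xnodeB], turns differences of nodes into the linear factors found in [planch]. *)
Lemma xnodeB_ynode a b : xnode R a - ynode R b = (a%:R + b%:R) * (a%:R + 1 - b%:R) / 2.
Proof. by rewrite xnodeE ynodeE; field. Qed.

Lemma xnodeB a b : xnode R a - xnode R b = (a%:R - b%:R) * (a%:R + b%:R + 1) / 2.
Proof. by rewrite !xnodeE; field. Qed.

(** The weight is F(lambda+) / F(lambda), compared factor by factor. If the enlarged sequence is not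
    strict, a factor a - b makes the left side vanish too. *)
Lemma planch_incr l i : is_strict l -> (i <= size l)%N ->
  planch (incr_nth l i) = planch l * weight R l i.
Proof.
elim: l i => [|a l IH] i sal il.
  case: i il => // _; rewrite /= big_nil /weight /numer /= big_nil.
  by rewrite denom_nil derivX !hornerC expr0 -[1`!]/1%N !(divr1, mulr1).
have := sal; rewrite is_strict_cons => /and3P[a0 /allP al sl].
have neq b : (b < a)%N -> (a%:R - b%:R != 0 :> R).
  by move=> lt; rewrite subr_eq0 eqr_nat gtn_eqF.
have pos n : n%:R + 1 != 0 :> R by rewrite natr1 pnatr_eq0.
have a_neq0 : a%:R != 0 :> R by rewrite pnatr_eq0 -lt0n.
have pos2 b : a%:R + b%:R != 0 :> R.
  by rewrite -natrD pnatr_eq0 -lt0n addn_gt0 a0.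
have pos3 b : a%:R + b%:R + 1 != 0 :> R by rewrite -natrD pos.
have fa : a`!%:R != 0 :> R by rewrite pnatr_eq0 -lt0n fact_gt0.
case: i il => [_|i il].
  rewrite weight_head /=.
  have -> : \prod_(b <- l) ((a.+1%:R - b%:R) / (a.+1%:R + b%:R)) =
     \prod_(b <- l) ((a%:R - b%:R) / (a%:R + b%:R)) *
     \prod_(b <- l) ((xnode R a - ynode R b) / (xnode R a - xnode R b)) :> R.
    rewrite -big_split big_seq [RHS]big_seq; apply: eq_bigr => b /al /neq nb /=.
    rewrite xnodeB xnodeB_ynode -natr1; field.
    by rewrite nb pos2 pos3.
  (* (x_a - y_a) / x_a = 2 / (a + 1) is the quotient of 2^a / (a + 1)! by 2^(a-1) / a!. *)
  rewrite xnodeB_ynode xnodeE factS natrM -natr1 -[in 2 ^+ a](prednK a0) exprS.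
  by field; rewrite a_neq0 fa pos.
rewrite weight_tail //= IH //.
(* The pair (a, m) changes its factor from phi m to phi (m + 1), and phi (m + 1) / phi m = (x_m -
   y_a) / (x_m - x_a). *)
set phi := fun b : nat => (a%:R - b%:R) / (a%:R + b%:R) : R.
have phi0 : phi 0%N = 1 by rewrite /phi subr0 addr0 divff.
have := prod_incr_nth phi0 (il : (i <= size l)%N).
set m := nth 0%N l i; have ma : (m < a)%N.
  have [lt|ge] := ltnP i (size l); first by apply/al/mem_nth.
  by rewrite /m nth_default.
have phim : phi m != 0 by rewrite mulf_neq0 ?invr_neq0 ?neq.
move=> /(canRL (mulfK phim)) ->; rewrite xnodeB xnodeB_ynode /phi -natr1.
have mn : m%:R - a%:R != 0 :> R by rewrite -opprB oppr_eq0 neq.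
by field; rewrite fa mn neq // [m%:R + a%:R]addrC pos2 pos3.
Qed.

End Plancherel.

(** * Linear extensions *)

Section LinearExtensions.
Variables (T : eqType) (r : rel T).
Implicit Types (s t : seq T) (b : T).

(** Linear extensions listed as orderings. The relation used later, [box_lt], is not transitive, so
    all pairs are tested. *)
Definition linexts s := [seq t <- permutations s | pairwise (fun x y => ~~ r y x) t].

Lemma mem_linexts s t :
  (t \in linexts s) = perm_eq t s && pairwise (fun x y => ~~ r y x) t.
Proof. by rewrite mem_filter mem_permutations andbC. Qed.

Lemma linexts_uniq s : uniq (linexts s).
Proof. exact/filter_uniq/permutations_uniq. Qed.

Lemma size_linexts_perm s s' : perm_eq s s' -> size (linexts s) = size (linexts s').
Proof. by move=> ss; apply/perm_size/perm_filter/perm_permutations. Qed.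

Definition minimal s b := all (fun y => ~~ r y b) s.

(** Classify linear extensions by their first element, which must be minimal. *)
Lemma size_linexts_rec s : irreflexive r -> uniq s -> s != [::] ->
  size (linexts s) = \sum_(b <- s | minimal s b) size (linexts (rem b s)).
Proof.
move=> irr us s0.
have /perm_size-> : perm_eq (linexts s)
    [seq b :: t | b <- filter (minimal s) s, t <- linexts (rem b s)].
  apply: uniq_perm; first exact: linexts_uniq.
    apply: allpairs_uniq_dep => [|b _|]; rewrite ?linexts_uniq ?filter_uniq //.
    by move=> [b t] [b' t'] _ _ /= [-> ->].
  move=> t; rewrite mem_linexts; apply/andP/allpairsPdep => [[]|[b [t' []]]].
    case: t => [|b t]; first by move/perm_size/esym/size0nil => e; rewrite e in s0.
    move=> pe /=/andP[bt pt]; have bs : b \in s by rewrite -(perm_mem pe) mem_head.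
    exists b, t; split=> //.
      rewrite mem_filter bs andbT /minimal -(perm_all _ pe) /= irr /=.
      exact: bt.
    by rewrite mem_linexts pt andbT -(perm_cons b) (permPl pe) perm_to_rem.
  rewrite mem_filter => /andP[mb bs]; rewrite mem_linexts => /andP[pe pt] ->.
  have pe' : perm_eq (b :: t') s by rewrite (permPr (perm_to_rem bs)) perm_cons.
  split=> //=; rewrite pt andbT; move: mb; rewrite /minimal -(perm_all _ pe').
  by case/andP.
rewrite size_allpairs_dep sumnE big_map big_filter.
by apply: eq_bigr => b _; rewrite ?size_map.
Qed.

(** Listing the elements by increasing number turns a filling into a linear extension; the inverse F
    records positions. *)
Lemma card_fillings s x0 (n := size s) : irreflexive r -> uniq s ->
  #|[set f : {ffun 'I_n -> 'I_n} | injectiveb f &&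
     [forall k1 : 'I_n, forall k2 : 'I_n,
        r (nth x0 s k1) (nth x0 s k2) ==> (f k1 < f k2)%N]]| = size (linexts s).
Proof.
move=> irr us.
pose F t : {ffun 'I_n -> 'I_n} := [ffun k : 'I_n => insubd k (index (nth x0 s k) t)].
have FE t (k : 'I_n) : perm_eq t s -> F t k = index (nth x0 s k) t :> nat.
  move=> pe; rewrite ffunE val_insubd.
  suff -> : (index (nth x0 s k) t < n)%N by [].
  by rewrite -[ltnRHS](perm_size pe) index_mem (perm_mem pe) mem_nth.
rewrite -(size_map F); have/card_uniqP <- : uniq (map F (linexts s)).
  rewrite map_inj_in_uniq ?linexts_uniq // => t t'.
  rewrite !mem_linexts => /andP[pe _] /andP[pe' _] eF.
  have st : size t = size t' by rewrite (perm_size pe) (perm_size pe').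
  apply: (@eq_from_nth _ x0) => // i it; set x := nth x0 t i.
  have xs : x \in s by rewrite -(perm_mem pe) mem_nth.
  have lt : (index x s < n)%N by rewrite index_mem.
  have eF' : index x t = index x t'.
    by have := FE t (Ordinal lt) pe; rewrite eF (FE t' (Ordinal lt) pe') /=
      nth_index //.
  have : index x t' = i by rewrite -eF' index_uniq // (perm_uniq pe).
  by move=> e; rewrite -[in RHS]e nth_index // (perm_mem pe').
apply: eq_card => f; rewrite inE; apply/andP/mapP => [[/injectiveP finj]|[t]].
  move/forallP=> fr; pose g : 'I_n -> 'I_n := invF finj.
  have gK : cancel f g by exact: invF_f.
  have fK : cancel g f by exact: f_invF.
  pose t := [seq nth x0 s (g i) | i <- enum 'I_n].
  have ninj : injective (fun i : 'I_n => nth x0 s (g i)).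
    move=> i j /eqP; rewrite nth_uniq // => /eqP/val_inj e.
    by rewrite -(fK i) e fK.
  have st : size t = n by rewrite size_map size_enum_ord.
  have pe : perm_eq t s.
    apply: uniq_perm => //; first by rewrite map_inj_uniq ?enum_uniq.
    have ut : uniq t by rewrite map_inj_uniq ?enum_uniq.
    have sub : {subset t <= s} by move=> _ /mapP[i _ ->]; rewrite mem_nth.
    by have [] := uniq_min_size ut sub; rewrite ?st.
  have it (i : 'I_n) : index (nth x0 s i) t = f i.
    have := index_map ninj (enum 'I_n) (f i); rewrite /= gK => ->.
    exact: index_enum_ord.
  exists t; last by apply/ffunP => k; apply: val_inj; rewrite /= FE // it.
  rewrite mem_linexts pe; apply/(pairwiseP x0) => i j; rewrite !inE st => li lj ij.
  have nthE k (lk : (k < n)%N) : nth x0 t k = nth x0 s (g (Ordinal lk)).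
    rewrite (nth_map (Ordinal lk)) ?size_enum_ord //; congr (nth _ _ (g _)).
    by apply: val_inj; rewrite /= nth_enum_ord.
  rewrite (nthE i li) (nthE j lj); apply/negP => rji.
  have /forallP/(_ (g (Ordinal li))) := fr (g (Ordinal lj)).
  by rewrite rji /= !fK /= ltnNge ltnW.
rewrite mem_linexts => /andP[pe /(pairwiseP x0) pt] ->; split.
  apply/injectiveP => i j /(congr1 val); rewrite /= !FE // => e.
  have : nth x0 t (index (nth x0 s i) t) = nth x0 t (index (nth x0 s j) t) by rewrite e.
  rewrite !nth_index ?(perm_mem pe) ?mem_nth // => /eqP.
  by rewrite nth_uniq // => /eqP/val_inj.
apply/forallP => i; apply/forallP => j; apply/implyP => rij; rewrite !FE //.
rewrite ltnNge leq_eqVlt; apply/negP => /orP[/eqP e|lt].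
  have : nth x0 t (index (nth x0 s i) t) = nth x0 t (index (nth x0 s j) t) by rewrite e.
  by rewrite !nth_index ?(perm_mem pe) ?mem_nth // => e'; rewrite e' irr in rij.
have := pt _ _ _ _ lt; rewrite !inE !index_mem !(perm_mem pe) !mem_nth //
  => /(_ isT isT).
by rewrite !nth_index ?(perm_mem pe) ?mem_nth // rij.
Qed.
End LinearExtensions.

(** * Skew standard tableaux *)

Lemma mem_boxes l b :
  (b \in boxes l) = [&& 0 < b.1, b.1 < b.2 & b.2 <= b.1 + part l b.1]%N.
Proof.
case: b => i j; apply/flatten_mapP/idP => [[k _ /mapP[k'
  + [-> ->]]]|/=/and3P[i0 ij jl]].
  rewrite mem_iota /=; case: k => [|k] h; first by rewrite addn0 in h; lia.
  by apply/and3P; split=> //; lia.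
exists i.
  rewrite mem_iota i0 /= ltnS leqNgt; apply/negP => si.
  by case: i i0 ij jl si => // i _ ij jl si; rewrite /= nth_default // in jl; lia.
by apply/mapP; exists j; rewrite // mem_iota ij addSn ltnS.
Qed.

Lemma boxes_uniq l : uniq (boxes l).
Proof.
elim: l => // a l IH; rewrite boxes_cons cat_uniq !map_inj_uniq ?iota_uniq ?IH.
- rewrite andbT; apply/hasPn => _ /mapP[b /boxes_gt/andP[b0 _] ->].
  by apply/mapP => -[j _ [e]]; rewrite e in b0.
- by move=> [i j] [i' j'] [-> ->].
- by move=> j j' [].
Qed.

Lemma size_boxes l : size (boxes l) = psize l.
Proof.
by elim: l => //= a l IH; rewrite boxes_cons size_cat !size_map size_iota IH.
Qed.

(** At the last index the default 0 makes the inequality express positivity. *)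
Lemma is_strictP l :
  reflect (forall i, i < size l -> nth 0 l i.+1 < nth 0 l i)%N (is_strict l).
Proof.
apply: (iffP idP) => [sl i il|].
  have [lt|ge] := ltnP i.+1 (size l).
    by have := is_strict_nth sl (_ : i <= i.+1 < size l)%N;
      rewrite leqnSn lt subSnn addn1; apply.
  by have := is_strict_nth_size sl il; rewrite [nth _ _ i.+1]nth_default //; lia.
elim: l => // a l IH sl; rewrite is_strict_cons.
have sl' : is_strict l by apply: IH => i il; exact: (sl i.+1).
have h0 : (nth 0 l 0 < a)%N by exact: (sl 0%N).
rewrite sl' (leq_ltn_trans _ h0) //= andbT; apply/(all_nthP 0%N) => i il.
have := is_strict_nth sl' (_ : 0 <= i < size l)%N; rewrite il => /(_ isT).
by lia.
Qed.

(** Local version of [is_strict_incr]: a longer row can only conflict with the row just above. *)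
Lemma is_strict_incr_pred l i : is_strict l -> (i <= size l)%N ->
  is_strict (incr_nth l i) = (i == 0%N) || ((nth 0 l i).+1 < nth 0 l i.-1)%N.
Proof.
move=> sl il; apply/is_strictP/idP => [h|h j].
  case: i il h => [//|i] il /(_ i).
  by rewrite !nth_incr_nth size_incr_nth eqxx gtn_eqF //= add0n add1n; case: ifP
    => h; apply; lia.
rewrite !nth_incr_nth size_incr_nth => hj.
have : (j < size l)%N \/ j = size l /\ i = size l by move: hj; case: ifP => h1 h2; lia.
case=> [jl|[-> ->]]; last by rewrite !nth_default // eqxx ltn_eqF.
have := is_strictP _ sl j jl.
have [e|_] := eqVneq i j.+1; last by case: (i == j); lia.
by move: h; rewrite e /= gtn_eqF //; lia.
Qed.

Lemma pcontainsP l m :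
  reflect (forall i, nth 0 m i <= nth 0 l i)%N (pcontains l m).
Proof.
apply: (iffP allP) => [h i|h [|i] _ //=].
have [lt|ge] := ltnP i (size m); last by rewrite (nth_default _ ge).
by apply: (h i.+1); rewrite mem_iota /=; lia.
Qed.

Lemma pcontains_trans l m m' : pcontains l m' -> pcontains m' m -> pcontains l m.
Proof.
move=> /pcontainsP h /pcontainsP h'; apply/pcontainsP => i;
  exact: leq_trans (h' i) (h i).
Qed.

Lemma pcontains_incr m i : pcontains (incr_nth m i) m.
Proof. by apply/pcontainsP => j; rewrite nth_incr_nth leq_addl. Qed.

Lemma leq_sumn_nth l m : (forall i, nth 0 m i <= nth 0 l i)%N -> (sumn m <= sumn l)%N.
Proof.
elim: m l => // b m IH [|a l] h /=.
  have := h 0%N; rewrite /= leqn0 => /eqP->; rewrite add0n.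
  by apply: (IH [::]) => i; have := h i.+1; rewrite !nth_nil.
by apply: leq_add; [exact: (h 0%N) | apply: IH => i; exact: (h i.+1)].
Qed.

Lemma pcontains_eq l m : is_strict l -> is_strict m -> pcontains l m ->
  sumn l = sumn m -> l = m.
Proof.
move=> + + /pcontainsP; elim: l m => [|a l IH] [|b m] //.
- by rewrite is_strict_cons => _ /and3P[b0 _ _] /(_ 0%N) /=; lia.
- by rewrite is_strict_cons => /and3P[a0 _ _] _ _ /=; lia.
rewrite !is_strict_cons => /and3P[_ _ sl] /and3P[_ _ sm] h /= e.
have h' i : (nth 0 m i <= nth 0 l i)%N := h i.+1.
have ba : (b <= a)%N := h 0%N.
have le := leq_sumn_nth h'.
have -> : a = b by lia.
by rewrite (IH m) //; lia.
Qed.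

(** The relation inside [nSYT], so that [card_fillings] applies up to conversion. *)
Definition box_lt (b1 b2 : nat * nat) :=
  ((b1.1 == b2.1) && (b1.2 < b2.2)%N) || ((b1.2 == b2.2) && (b1.1 < b2.1)%N).

Lemma box_lt_irr : irreflexive box_lt.
Proof. by move=> b; rewrite /box_lt !ltnn !andbF. Qed.

Lemma skew_boxes_uniq l m : uniq (skew_boxes l m).
Proof. exact/filter_uniq/boxes_uniq. Qed.

Lemma nSYTE l m : nSYT l m = size (linexts box_lt (skew_boxes l m)).
Proof. exact: (card_fillings (0, 0)%N box_lt_irr (skew_boxes_uniq l m)). Qed.

Definition new_box (m : seq nat) i : nat * nat := (i.+1, (i.+2 + nth 0 m i)%N).

Lemma mem_boxes_incr m i b :
  (b \in boxes (incr_nth m i)) = (b == new_box m i) || (b \in boxes m).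
Proof.
case: b => -[|r] c; rewrite !mem_boxes //= nth_incr_nth.
rewrite /new_box xpair_eqE eqSS [r == i]eq_sym.
by case: (eqVneq i r) => [->|_] //=; lia.
Qed.

Lemma mem_skew l m b : (b \in skew_boxes l m) = (b \in boxes l) && (b \notin boxes m).
Proof. by rewrite mem_filter andbC. Qed.

(** A box of lambda/mu is minimal exactly when no box of lambda/mu lies to its left or above it,
    that is, when it can be added to mu. *)
Lemma perm_minimal_skew l m : is_strict l -> is_strict m -> pcontains l m ->
  perm_eq [seq b <- skew_boxes l m | minimal box_lt (skew_boxes l m) b]
    [seq new_box m i | i <- iota 0 (size m).+1
       & is_strict (incr_nth m i) && pcontains l (incr_nth m i)].
Proof.
move=> sl sm /pcontainsP lm; set S := [seq i <- iota _ _ | _].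
have memS i : (i \in S) =
    [&& is_strict (incr_nth m i), pcontains l (incr_nth m i) & i <= size m]%N.
  by rewrite mem_filter mem_iota add0n ltnS leq0n /= -andbA.
apply: uniq_perm; first exact/filter_uniq/skew_boxes_uniq.
  rewrite map_inj_uniq; last by move=> i j [].
  exact/filter_uniq/iota_uniq.
move=> b; rewrite mem_filter; apply/andP/mapP => [[/allP mb]|[i + ->]].
  case: b mb => -[|i] c mb; rewrite mem_skew !mem_boxes //= => /andP[/andP[ic cl] cm].
  have nlt b : b \in skew_boxes l m -> ~~ box_lt b (i.+1, c) := mb b.
  (* Otherwise the left neighbour would be a smaller box of the skew shape. *)
  have ec : c = (i.+2 + nth 0 m i)%N.
    apply/eqP; rewrite eqn_leq; apply/andP; split; last by lia.
    rewrite leqNgt; apply/negP => lt; have := nlt (i.+1, c.-1).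
    rewrite mem_skew !mem_boxes /box_lt /=; lia.
  have il : (i < size l)%N.
    by rewrite ltnNge; apply/negP => ge; rewrite (nth_default _ ge) in cl; lia.
  (* Otherwise the box above would be one; it lies in [l] by strictness. *)
  have up : (i == 0%N) || ((nth 0 m i).+1 < nth 0 m i.-1)%N.
    case: i {mb} ic cl cm nlt ec il => // i ic cl cm nlt ec il /=.
    rewrite ltnNge; apply/negP => le; have := nlt (i.+1, c).
    have := is_strictP _ sl i (ltnW il).
    rewrite mem_skew !mem_boxes /box_lt /=; lia.
  have im : (i <= size m)%N.
    rewrite leqNgt; apply/negP => lt; move: up; rewrite !nth_default //; lia.
  exists i; last by rewrite ec.
  rewrite memS im andbT is_strict_incr_pred // up /=.
  apply/pcontainsP => j; rewrite nth_incr_nth; have := lm j.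
  by case: (eqVneq i j) => [<-|_]; lia.
rewrite memS => /and3P[si /pcontainsP li im].
have lii := li i; rewrite nth_incr_nth eqxx in lii.
rewrite mem_skew !mem_boxes /=; split; last by lia.
apply/allP => -[[|r] c]; rewrite mem_skew !mem_boxes //= => h.
move: si; rewrite is_strict_incr_pred // => si.
apply/negP; rewrite /box_lt /= => /orP[|/andP[/eqP ec ri]];
  first by move=> /andP[/eqP[e] ci]; rewrite e in h; lia.
case: i im si ri ec lii {li} => [|i] im /=; first by lia.
move=> si ri ec _; have := is_strict_nth sm (_ : r <= i < size m)%N.
by move/(_ ltac:(lia)); lia.
Qed.

Lemma perm_rem_skew l m i : pcontains l (incr_nth m i) ->
  perm_eq (rem (new_box m i) (skew_boxes l m)) (skew_boxes l (incr_nth m i)).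
Proof.
move=> lm; apply: uniq_perm; rewrite ?rem_uniq ?skew_boxes_uniq // => b.
rewrite mem_rem_uniq ?skew_boxes_uniq // inE !mem_skew mem_boxes_incr negb_or.
by rewrite andbCA.
Qed.

Lemma skew_boxes_neq_nil l m : (sumn m < sumn l)%N -> skew_boxes l m != [::].
Proof.
move=> lt; apply/negP => /eqP e.
have sub : {subset boxes l <= boxes m}.
  move=> b bl; apply/negPn/negP => bm.
  by have : b \in skew_boxes l m; [rewrite mem_skew bl | rewrite e].
by have := uniq_leq_size (boxes_uniq l) sub; rewrite !size_boxes /psize; lia.
Qed.

(** Remove the box with the smallest entry. The recursion enlarges mu, the argument on which U
    acts. *)
Lemma nSYT_rec l m : is_strict l -> is_strict m -> pcontains l m ->
    (sumn m < sumn l)%N ->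
  nSYT l m = \sum_(i < (size m).+1
      | is_strict (incr_nth m i) && pcontains l (incr_nth m i)) nSYT l (incr_nth m i).
Proof.
move=> sl sm lm lt; rewrite nSYTE size_linexts_rec ?skew_boxes_uniq
  ?skew_boxes_neq_nil //;
  last exact: box_lt_irr.
rewrite -big_filter (perm_big _ (perm_minimal_skew sl sm lm)) big_map big_filter.
rewrite -(big_mkord (fun i => is_strict (incr_nth m i) && pcontains l (incr_nth m i))
  (fun i => nSYT l (incr_nth m i))).
rewrite /index_iota subn0.
by apply: eq_bigr => i /andP[_ li]; rewrite nSYTE;
  exact/size_linexts_perm/perm_rem_skew.
Qed.

Lemma nSYT_refl m : nSYT m m = 1%N.
Proof.
rewrite nSYTE (_ : skew_boxes m m = [::]) //.
apply/eqP; rewrite -size_eq0 size_filter -leqn0 leqNgt -has_count.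
by apply/hasPn => b bm; rewrite /in_diag bm.
Qed.

(** The summation range misses no strict partition of N: such a partition is determined by its set
    of parts, all at most N. *)
Lemma mem_small_strict_parts l N : is_strict l -> psize l = N ->
  l \in small_strict_parts N.
Proof.
move=> sl lN; rewrite mem_undup; apply/imageP.
have leN x : x \in l -> (x <= N)%N.
  rewrite -lN; elim: (l) => // a l' IH; rewrite inE /psize /= => /orP[/eqP->|/IH];
    rewrite /psize; lia.
have gt0 x : x \in l -> (0 < x)%N by move: sl => /andP[_ /allP]; apply.
exists [set i : 'I_N.+1 | val i \in l] => //; rewrite /part_of_set.
have geq_anti : antisymmetric geq by move=> x y /andP[]; rewrite /=; lia.
have geq_tr : transitive geq by move=> x y z; rewrite /=; lia.
apply: (sorted_eq geq_tr geq_anti).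
- by case/andP: sl => + _; apply: sub_sorted => x y /ltnW.
- by apply: sort_sorted => x y; rewrite /=; lia.
rewrite perm_sym perm_sort; apply: uniq_perm.
- by rewrite map_inj_uniq => [|i j /val_inj] //; exact/filter_uniq/enum_uniq.
- by have := is_strict_uniq sl; rewrite rcons_uniq => /andP[].
move=> x; apply/mapP/idP => [[i + ->]|xl].
  by rewrite mem_filter mem_enum inE => /andP[].
have lt : (x < N.+1)%N by rewrite ltnS leN.
exists (Ordinal lt) => //.
by rewrite mem_filter mem_enum inE /= xl andbT -lt0n gt0.
Qed.

(** * Sums over skew shapes as iterates of U *)

Section SkewSum.
Variable R : numFieldType.

Definition planch_sum (g : seq nat -> R) m N : R :=
  \sum_(l <- small_strict_parts N | is_strict l && pcontains l m && (psize l == N))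
     planch R l * (nSYT l m)%:R * g l.

(** Sorting by the first added box splits off one application of U, since F(mu+) is F(mu) times the
    weight. *)
Lemma planch_sumE g m n : is_strict m ->
  planch_sum g m (psize m + n) = planch R m * iter n (@step R) g m.
Proof.
elim: n m => [|n IH] m sm.
  rewrite addn0 /planch_sum (eq_bigl (pred1 m)) => [|l]; last first.
    apply/andP/eqP => [[/andP[sl lm] /eqP e]|->]; first exact: pcontains_eq.
    by rewrite sm eqxx; split=> //; apply/pcontainsP.
  rewrite -big_filter filter_pred1_uniq ?undup_uniq ?mem_small_strict_parts //.
  by rewrite big_seq1 nSYT_refl mulr1.
set N := (psize m + n.+1)%N.
transitivity (\sum_(i < (size m).+1 | is_strict (incr_nth m i))
  planch_sum g (incr_nth m i) N).
  rewrite /planch_sum.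
  transitivity (\sum_(l <- small_strict_parts N |
    is_strict l && pcontains l m && (psize l == N))
     \sum_(i < (size m).+1 | is_strict (incr_nth m i) && pcontains l (incr_nth m i))
        planch R l * (nSYT l (incr_nth m i))%:R * g l).
    apply: eq_bigr => l /andP[/andP[sl lm] /eqP e].
    rewrite nSYT_rec //; last by rewrite -/(psize m) -/(psize l) e /N; lia.
    by rewrite natr_sum mulr_sumr mulr_suml.
  rewrite (exchange_big_dep (fun i : 'I_(size m).+1 => is_strict (incr_nth m i))) /=;
    last first.
    by move=> l i _ /andP[].
  apply: eq_bigr => i si; apply: eq_bigl => l; rewrite si /=.
  have [li|_] := boolP (pcontains l (incr_nth m i)); last by rewrite !andbF.
  by rewrite (pcontains_trans li (pcontains_incr m i)) !andbT.
rewrite /= /step mulr_sumr [RHS](bigID (fun i : 'I__ => is_strict (incr_nth m i))) /=.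
rewrite [X in _ + X]big1 ?addr0 => [|i ns];
  last by rewrite weight_eq0 ?mul0r ?mulr0 // -ltnS.
apply: eq_bigr => i si; have im : (i <= size m)%N by rewrite -ltnS.
by rewrite mulrA -planch_incr // -IH // /psize sumn_incr_nth // addSnnS.
Qed.

End SkewSum.

(** * Symmetric functions of contents *)

Section Contents.
Variable R : numFieldType.
Implicit Types (s : seq R) (l : seq nat).

Lemma filtX a f n : @filt R a.+1 f -> filt (a * n).+1 (fun l => f l ^+ n).
Proof.
move=> ff; elim: n => [|n IH]; first by rewrite muln0; apply: filt_cst.
by rewrite mulnS; apply: (filt_ext _ (filtM ff IH)) => l _; rewrite exprS.
Qed.

Lemma filt_prod (I : Type) (r : seq I) (a : I -> nat) (f : I -> seq nat -> R) :
  (forall i, filt (a i).+1 (f i)) ->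
  filt (\sum_(i <- r) a i).+1 (fun l => \prod_(i <- r) f i l).
Proof.
move=> ff; elim: r => [|i r IH].
  by rewrite big_nil; apply: (filt_ext _ (filt_cst 1)) => l _; rewrite big_nil.
by rewrite big_cons; apply: (filt_ext _ (filtM (ff i) IH)) => l _; rewrite big_cons.
Qed.

Lemma filt_sum (I : eqType) (r : seq I) d (f : I -> seq nat -> R) :
  {in r, forall i, filt d (f i)} -> filt d (fun l => \sum_(i <- r) f i l).
Proof.
elim: r => [|i r IH] ff.
  by apply: filt_zero => l _; rewrite big_nil.
have ffr : {in r, forall i, filt d (f i)} by move=> j jr; apply: ff;
  rewrite inE jr orbT.
have := filtD (ff i (mem_head i r)) (IH ffr).
by apply: filt_ext => l _; rewrite big_cons.
Qed.

Lemma content_polyE l :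
  content_poly R l = \prod_(b <- boxes l) (1 + 'C(content b, 2)%:R *: 'X).
Proof.
elim: l => [|a l IH]; first by rewrite /content_poly /boxes /= !big_nil.
rewrite boxes_cons big_cat !big_map /= /content_poly big_cons -/(content_poly R l) IH.
congr (_ * _).
rewrite /index_iota subSS subn0 -[2%N]/(1 + 1)%N iotaDl big_map.
by apply: eq_bigr => c _; rewrite /content /= add1n subn1.
Qed.

(** Vieta; variables beyond [s] default to 0 and contribute factors 1. *)
Lemma mesym_eval s n k : (size s <= n)%N ->
  (mesym n R k).@[fun i : 'I_n => s`_i] = (\prod_(c <- s) (1 + c *: 'X))`_k.
Proof.
move=> sn.
have -> : \prod_(c <- s) (1 + c *: 'X) = \prod_(i < n) (1 + s`_i *: 'X) :> {poly R}.
  rewrite (big_nth 0) -(big_mkord xpredT (fun i => 1 + s`_i *: 'X)).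
  rewrite (@big_cat_nat _ _ _ (size s) 0 n) //= [X in _ = _ * X]big_nat_cond.
  rewrite [X in _ = _ * X]big1 ?mulr1 // => i /andP[/andP[si _] _].
  by rewrite nth_default // scale0r addr0.
under eq_bigr => i _ do rewrite addrC.
rewrite bigA_distr coef_sum /mesym raddf_sum /= big_mkcond; apply: eq_bigr => J _.
have -> : \prod_i (if i \in J then s`_i *: 'X else 1) =
  (\prod_(i in J) s`_i) *: 'X^#|J| :> {poly R}.
  by rewrite -big_mkcond /= scaler_prod prodr_const.
rewrite coefZ coefXn eq_sym; case: eqP => _; last by rewrite mulr0.
rewrite mulr1 rmorph_prod; apply: eq_bigr => i _; exact: mevalXU.
Qed.

Lemma symfun_eval_pad (Q : forall k, {mpoly R[k]}) s k n : is_symfun Q ->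
  (size s <= k <= n)%N ->
  (Q n).@[fun i : 'I_n => s`_i] = (Q k).@[fun i : 'I_k => s`_i].
Proof.
case=> _ _ compat /andP[sk kn]; rewrite -(subnKC kn); elim: (n - k)%N => [|d IH].
  by rewrite addn0.
rewrite addnS -IH -[RHS]compat; apply: meval_eq => i; rewrite /ext0.
case: unliftP => [j|] ->; first by rewrite /= /bump leqNgt ltn_ord.
by rewrite nth_default // (leq_trans sk) // leq_addr.
Qed.

(** Q in N variables is a polynomial in elementary symmetric functions. Its weighted degree is
    bounded independently of N, hence so is D, though f depends on N. *)
Lemma Qcontents_filt (Q : forall k, {mpoly R[k]}) : is_symfun Q ->
  exists D, forall N, exists2 f, filt D f &
    forall l, (psize l <= N)%N -> Qcontents Q l = f l.
Proof.
move=> symQ; have [sym [d dQ] _] := symQ; exists d.*2.+1 => N.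
have [T [QT wT]] := sym_fundamental (sym N).
pose e l (i : nat) : R := (content_poly R l)`_i.+1.
exists (fun l => \sum_(m <- msupp T) T@_m * \prod_(i < N) e l i ^+ m i).
  apply: filt_sum => m mT; rewrite -[_.+1]/(0 + d.*2).+1.
  apply: filtM; first exact: filt_cst.
  have := @filt_prod _ (index_enum 'I_N) (fun i : 'I_N => (i.+1.*2 * m i)%N)
    (fun i l => e l i ^+ m i) (fun i => filtX (m i) (filt_content R i.+1)).
  apply: filt_le; rewrite ltnS.
  (* [mnmwgt] gives e_i weight i, half its weight in [filt]. *)
  have : (mnmwgt m <= d)%N.
    by apply: leq_trans (dQ N); apply: leq_trans wT; apply: ltnW;
      apply: mmeasure_mnm_lt.
  rewrite -leq_double; apply: leq_trans; rewrite /mnmwgt -mul2n big_distrr /=.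
  by apply: leq_sum => i _; rewrite -mul2n -mulnA [(_ * m i)%N]mulnC.
move=> l lN; pose s : seq R := [seq 'C(content b, 2)%:R | b <- boxes l].
have ss : size s = size (boxes l) by rewrite size_map.
have -> : Qcontents Q l = (Q (size (boxes l))).@[fun i => s`_i].
  by apply: meval_eq => i; rewrite (nth_map (0, 0)%N).
rewrite -(@symfun_eval_pad _ _ _ N) //; last by rewrite ss leqnn size_boxes.
rewrite -QT comp_mpoly_meval mevalE; apply: eq_bigr => m _; congr (_ * _).
apply: eq_bigr => i _; congr (_ ^+ _).
rewrite tnth_mktuple mesym_eval ?ss ?size_boxes //.
by rewrite /e content_polyE /s big_map.
Qed.

End Contents.

(** * Polynomials in the binomial basis *)

Section BinomialBasis.
Variable R : numFieldType.

Lemma prod_subr_ffact n k : \prod_(i < k) (n%:R - i%:R) = (n ^_ k)%:R :> R.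
Proof.
elim: k => [|k IH]; first by rewrite big_ord0 ffactn0.
rewrite big_ord_recr IH ffactnSr natrM /=.
have [kn|nk] := leqP k n; first by rewrite natrB.
by rewrite ffact_small // !mul0r.
Qed.

Lemma binomial_sum_poly (a : nat -> R) d :
  exists p : {poly R}, forall n, p.[n%:R] = \sum_(k < d) a k * 'C(n, k)%:R.
Proof.
exists (\sum_(k < d) (a k / k`!%:R) *: \prod_(i < k) ('X - (i%:R)%:P)) => n.
rewrite horner_sum; apply: eq_bigr => k _; rewrite hornerZ horner_prod.
under eq_bigr => i _ do rewrite hornerXsubC.
rewrite prod_subr_ffact -bin_ffact natrM -mulrA; congr (_ * _).
by rewrite mulrC mulfK // pnatr_eq0 -lt0n fact_gt0.
Qed.

(** The matrix of the binom(n, k) with n, k < d is unitriangular. *)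
Lemma binomial_sum_inj (a b : nat -> R) d :
  (forall n, (n < d)%N -> \sum_(k < d) a k * 'C(n, k)%:R =
    \sum_(k < d) b k * 'C(n, k)%:R) ->
  forall k, (k < d)%N -> a k = b k.
Proof.
move=> ab; elim/ltn_ind => n IH nd; have := ab n nd.
rewrite (bigD1 (Ordinal nd)) // [RHS](bigD1 (Ordinal nd)) //= binn !mulr1.
rewrite [X in _ + X](_ : _ = \sum_(k < d | k != Ordinal nd) b k * 'C(n, k)%:R).
  by move/addIr.
apply: eq_bigr => k ne; have [kn|nk] := ltnP k n; first by rewrite IH.
have lt : (n < k)%N by move: ne nk; rewrite -val_eqE /=; lia.
by rewrite bin_small // !mulr0.
Qed.

End BinomialBasis.

(** F(lambda) absorbs the power of 2 that depends on lambda; what remains depends on mu only. *)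
Lemma Psum_planch (R : numFieldType) (Q : forall k, {mpoly R[k]}) mu n :
  is_strict mu ->
  Psum Q mu n = 2 ^ (size mu)%:Z / 2 ^ (psize mu)%:Z *
                planch_sum (Qcontents Q) mu (psize mu + n).
Proof.
move=> sm; rewrite /planch_sum mulr_sumr; apply: eq_bigr => l /andP[/andP[sl lm] _].
rewrite planchE // /plength.
have two0 : 2 != 0 :> R by rewrite pnatr_eq0.
have sz := size_le_sumn sl.
have -> : ((psize l)%:Z - (psize mu)%:Z - (size l)%:Z + (size mu)%:Z)%R =
  ((size mu)%:Z - (psize mu)%:Z + (sumn l - size l)%N%:Z)%R.
  by rewrite -(subzn sz) /psize; ring.
by rewrite expfzDr // expfzDr // -invr_expz -!exprnP; ring.
Qed.

Theorem theorem1p1 (R : numFieldType) (Q : forall k : nat, {mpoly R[k]})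
    (mu : seq nat) :
  is_symfun Q -> is_strict mu ->
  exists p : {poly R}, forall n : nat, Psum Q mu n = p.[n%:R].
Proof.
move=> symQ sm; have [D QD] := Qcontents_filt symQ.
(* The functions of [QD] depend on N, but as D does not, the coefficients b are
   already determined by the first D values. *)
have local N : exists b : nat -> R, forall n, (psize mu + n <= N)%N ->
    Psum Q mu n = \sum_(k < D) b k * 'C(n, k)%:R.
  have [f ff Qf] := QD N; have [a Ea] := iter_step_filt ff sm.
  exists (fun k => 2 ^ (size mu)%:Z / 2 ^ (psize mu)%:Z * planch R mu * a k) => n nN.
  rewrite Psum_planch //.
  have -> : planch_sum (Qcontents Q) mu (psize mu + n) = planch_sum f mu (psize mu + n).
    by apply: eq_bigr => l /andP[_ /eqP e]; rewrite Qf ?e.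
  rewrite planch_sumE // Ea mulrA mulr_sumr.
  by apply: eq_bigr => k _; rewrite !mulrA.
have [b Eb] := local (psize mu + D)%N.
have [p Ep] := binomial_sum_poly b D; exists p => n; rewrite Ep.
(* This bound covers both n and the first D values, where b' must agree with b. *)
have [b' Eb'] := local (psize mu + D + n)%N.
rewrite Eb'; last by lia.
apply: eq_bigr => k _; congr (_ * _).
apply: (@binomial_sum_inj _ _ _ D) => // i iD.
by rewrite -Eb ?leq_add2l ?(ltnW iD) // Eb' //; lia.
Qed.
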